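(* Let $P$ be a nonempty set, $X$ and $Y$ normed spaces, $F:P\times X\rightrightarrows Y$ a set-valued mapping such that $\operatorname{gph}F_p$ is convex for all $p\in P$, $\bar x\in X$, $\bar y\in Y$, $\alpha>0$, $\delta\in]0,+\infty]$ and $\mu\in]0,+\infty]$. If $F$ is $\alpha$-subregular in $x$ uniformly in $p$ over $P$ at $(\bar x,\bar y)$ with $\delta$ and $\mu$, then for all $p\in P$, $x\in B_\delta(\bar x)$ and $y\in Y$ satisfying $x\notin F_p^{-1}(\bar y)$ and $y\in F(p,x)\cap B_{\alpha\mu}(\bar y)$, and all $y^*\in Y^*$ satisfying $\|y^*\|=1$ and $\langle y^*,y-\bar y\rangle=\|y-\bar y\|$, the inequality $$d_\gamma\big((0,-y^* ),N_{\operatorname{gph}F_p}(x,y)\big)\ge\alpha$$ is satisfied with $\gamma:=\alpha^{-1}$.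
   Context: $B_r(z)$ denotes the open ball with center $z$ and radius $r\in]0,+\infty]$. $d(z,\emptyset)=+\infty$. For $p\in P$, $F_p:=F(p,\cdot)$, $\operatorname{gph}F_p=\{(x,y)\mid y\in F(p,x)\}$, $F_p^{-1}(y)=\{x\in X\mid y\in F(p,x)\}$. Definition. $F$ is $\alpha$-subregular in $x$ uniformly in $p$ over $P$ at $(\bar x,\bar y)$ with $\delta$ and $\mu$ if $\alpha\, d(x,F_p^{-1}(\bar y))\le d(\bar y,F(p,x))$ for all $p\in P$ and $x\in B_\delta(\bar x)$ with $d(\bar y,F(p,x))<\alpha\mu$. For $\gamma>0$, $d_\gamma$ on $X^*\times Y^*$ is the distance induced by the norm $\|(x^*,y^* )\|_\gamma=\|x^*\|+\gamma^{-1}\|y^*\|$. $N_\Omega(\bar z)=\{z^*\mid\langle z^*,z-\bar z\rangle\le0\ \forall z\in\Omega\}$ is the normal cone of convex analysis. *)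

(* Defs.v *)
From HB Require Import structures.
From mathcomp Require Import all_boot all_order all_algebra.
From mathcomp Require Import all_classical all_reals all_analysis.

Set Implicit Arguments.
Unset Strict Implicit.
Unset Printing Implicit Defensive.

Import Order.TTheory GRing.Theory Num.Theory.
Import numFieldNormedType.Exports.

Local Open Scope classical_set_scope.
Local Open Scope ring_scope.

Definition cont_linear (R : realType) (X : normedModType R) :
    {pred (X -> R^o)} :=
  mem [set f : X -> R^o | linear f /\ continuous f].
Arguments cont_linear {R} X.

Lemma cont_linear_submod_closed (R : realType) (X : normedModType R) :
  submod_closed (cont_linear X).
Proof.
split=> [|a f g].
  rewrite inE; split=> [a u v|x]; last exact: cvg_cst.
  by rewrite /GRing.zero/= scaler0 addr0.
rewrite !inE => -[lf cf] [lg cg]; split=> [b u v|x].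
  rewrite !fctE lf lg !scalerDr !scalerA (mulrC a b) -!addrA.
  by congr (_ + _); rewrite addrCA.
by apply: continuousD; [exact/continuousZl_tmp/cf|exact: cg].
Qed.

HB.instance Definition _ (R : realType) (X : normedModType R) :=
  GRing.isSubmodClosed.Build R (X -> R^o) (cont_linear X)
    (@cont_linear_submod_closed R X).

Record dual (R : realType) (X : normedModType R) := Dual {
  dual_fun :> X -> R^o;
  dual_funP : dual_fun \in cont_linear X }.

Section dual_lmodule.
Context {R : realType} {X : normedModType R}.

HB.instance Definition _ := [isSub for @dual_fun R X].
HB.instance Definition _ := [Choice of dual X by <:].
HB.instance Definition _ := [SubChoice_isSubLmodule of dual X by <:].

Lemma dual_linear (f : dual X) : linear f.
Proof. by have := dual_funP f; rewrite inE => -[]. Qed.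

Lemma dual_continuous (f : dual X) : continuous f.
Proof. by have := dual_funP f; rewrite inE => -[]. Qed.

HB.instance Definition _ (f : dual X) :=
  GRing.isLinear.Build R X R^o *:%R (dual_fun f) (dual_linear f).

Lemma dualDE (f g : dual X) x : (f + g) x = f x + g x.
Proof. by []. Qed.

Lemma dualNE (f : dual X) x : (- f) x = - f x.
Proof. by []. Qed.

Lemma dualZE a (f : dual X) x : (a *: f) x = a * f x.
Proof. by []. Qed.

Lemma dual0E x : (0 : dual X) x = 0.
Proof. by []. Qed.

Lemma dualP (f g : dual X) : f =1 g -> f = g.
Proof. by move=> fg; apply/val_inj/funext. Qed.

End dual_lmodule.

Section dual_norm.
Context {R : realType} {X : normedModType R}.
Implicit Types f g : dual X.

Definition dual_norm f : R := sup [set `|f x| | x in [set x : X | `|x| <= 1]].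

Lemma dual_norm_has_ubound f :
  has_ubound [set `|f x| | x in [set x : X | `|x| <= 1]].
Proof.
have /linear_bounded_continuous/bounded_funP/(_ 1)[M fM] :=
  @dual_continuous _ _ f.
by exists M => _ [x /= x1 <-]; exact: fM.
Qed.

Lemma dual_norm_ub f x : `|x| <= 1 -> `|f x| <= dual_norm f.
Proof.
by move=> x1; apply: ub_le_sup; [exact: dual_norm_has_ubound|exists x].
Qed.

Lemma dual_norm_le f M : (forall x, `|x| <= 1 -> `|f x| <= M) ->
  dual_norm f <= M.
Proof.
move=> fM; apply: ge_sup => [|_ [x /= x1 <-]]; last exact: fM.
by exists `|f 0|, 0 => //=; rewrite normr0.
Qed.

Lemma dual_norm_ge0 f : 0 <= dual_norm f.
Proof. by rewrite (le_trans _ (@dual_norm_ub f 0 _)) ?normr0. Qed.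

Lemma ler_dual_norm f x : `|f x| <= dual_norm f * `|x|.
Proof.
have [->|x0] := eqVneq x 0; first by rewrite linear0 !normr0 mulr0.
have nx0 : 0 < `|x| by rewrite normr_gt0.
rewrite -ler_pdivrMr//.
have -> : `|f x| / `|x| = `|f (`|x|^-1 *: x)|.
  by rewrite linearZ/= normrM ger0_norm ?invr_ge0// mulrC.
apply: dual_norm_ub.
by rewrite normrZ ger0_norm ?invr_ge0// mulVf ?gt_eqF.
Qed.

Lemma dual_normD f g : dual_norm (f + g) <= dual_norm f + dual_norm g.
Proof.
apply: dual_norm_le => x x1; rewrite dualDE (le_trans (ler_normD _ _))//.
by rewrite lerD// dual_norm_ub.
Qed.

Lemma dual_normZ a f : dual_norm (a *: f) = `|a| * dual_norm f.
Proof.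
have le b h : dual_norm (b *: h) <= `|b| * dual_norm h.
  apply: dual_norm_le => x x1.
  by rewrite dualZE normrM ler_wpM2l// dual_norm_ub.
apply/eqP; rewrite eq_le le/=.
have [->|a0] := eqVneq a 0; first by rewrite normr0 mul0r dual_norm_ge0.
rewrite -ler_pdivlMl ?normr_gt0// -normfV (le_trans _ (le _ _))//.
by rewrite scalerA mulVf// scale1r.
Qed.

Lemma dual_norm0_eq0 f : dual_norm f = 0 -> f = 0.
Proof.
move=> f0; apply: dualP => x; apply/eqP; rewrite dual0E -normr_le0.
by rewrite (le_trans (ler_dual_norm f x))// f0 mul0r.
Qed.

HB.instance Definition _ := @Lmodule_isNormed.Build R (dual X)
  dual_norm dual_normD dual_normZ dual_norm0_eq0.

Lemma dual_normE f : `|f| = dual_norm f.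
Proof. by []. Qed.

End dual_norm.

(* For normed modules the library's extended distance is the one induced by
   the norm; in particular edist_inf A z is the infimum of `|z - a| for a in A,
   with value +oo when A is empty. *)
Lemma edist_normE (R : realType) (X : normedModType R) (x y : X) :
  edist (x, y) = `|x - y|%:E.
Proof.
apply/eqP; rewrite eq_le; apply/andP; split; last first.
  apply: le_ereal_inf_tmp => _ [r [r0 +] <-].
  by rewrite -ball_normE/= => /ltW; rewrite lee_fin.
apply/lee_addgt0Pr => e e0; rewrite -EFinD; apply: edist_fin => /=.
  by rewrite ltr_wpDl.
by rewrite -ball_normE/= ltrDl.
Qed.

Lemma edist_inf_normE (R : realType) (X : normedModType R) (A : set X) (z : X) :
  edist_inf A z = ereal_inf [set `|z - a|%:E | a in A].
Proof. by congr ereal_inf; apply: eq_imagel => a _; rewrite edist_normE. Qed.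

Section set_valued_mappings.
Context {R : realType} {P : Type} {X Y : normedModType R}.
Implicit Types (F : P -> X -> set Y) (G : X -> set Y).

(* Open ball whose radius may be +oo, unlike that of ball. *)
Definition eball (z : X) (r : \bar R) : set X :=
  [set x | (`|z - x|%:E < r)%E].

Definition gph G : set (X * Y) := [set z | G z.1 z.2].

Definition sv_inv G (y : Y) : set X := [set x | G x y].

Definition uniformly_subregular F (xbar : X) (ybar : Y)
    (alpha : R) (delta mu : \bar R) :=
  forall (p : P) (x : X), eball xbar delta x ->
    (edist_inf (F p x) ybar < alpha%:E * mu)%E ->
    (alpha%:E * edist_inf (sv_inv (F p) ybar) x <= edist_inf (F p x) ybar)%E.

End set_valued_mappings.

Section product_dual.
Context {R : realType} {X Y : normedModType R}.

(* Normal cone of convex analysis. The dual of X * Y is identified with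
   dual X * dual Y: a pair zs acts on z by zs.1 z.1 + zs.2 z.2. *)
Definition normal_cone (Omega : set (X * Y)) (zbar : X * Y) :
    set (dual X * dual Y) :=
  [set zs : dual X * dual Y | forall z, Omega z ->
    zs.1 (z - zbar).1 + zs.2 (z - zbar).2 <= 0].

Definition norm_gamma (gamma : R) (zs : dual X * dual Y) : R :=
  `|zs.1| + gamma^-1 * `|zs.2|.

Definition dist_gamma (gamma : R) (zs : dual X * dual Y)
    (A : set (dual X * dual Y)) : \bar R :=
  ereal_inf [set (norm_gamma gamma (zs - ws))%:E | ws in A].

End product_dual.

(* Main.v *)
(* Let (us, vs) be normal to the graph at (x, y) and put ws := vs + ys. Testing
   normality at the graph points (a, ybar) and using ys (y - ybar) = |y - ybar|
   gives |y - ybar| <= |us| |x - a| + |ws| |y - ybar|. By subregularity |x - a|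
   can be made arbitrarily close to |y - ybar| / alpha, or smaller; dividing by
   |y - ybar| > 0 yields alpha <= |us| + alpha |ws|. *)
Require Import Defs.
From mathcomp Require Import all_boot all_order all_algebra.
From mathcomp Require Import all_classical all_reals all_analysis.
From mathcomp Require Import ring lra.

Import Order.TTheory GRing.Theory Num.Theory.
Import numFieldNormedType.Exports.

Local Open Scope classical_set_scope.
Local Open Scope ring_scope.

(** The infimum need not be attained, hence the slack [s < t]; the finite bound [s] also forces [A]
    to be nonempty. *)
Lemma edist_inf_approx {R : realType} {X : normedModType R} {A : set X}
    {z : X} {s} (t : R) :
  (edist_inf A z <= s%:E)%E -> s < t -> exists2 a, A a & `|z - a| < t.
Proof.
rewrite edist_inf_normE => As st.
have /ereal_inf_lt[_ [a Aa <-]] : (ereal_inf [set `|z - a|%:E | a in A] < t%:E)%E.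
  by rewrite (le_lt_trans As)// lte_fin.
by rewrite lte_fin; exists a.
Qed.

Lemma edist_inf_le_norm {R : realType} {X : normedModType R} {A : set X}
    (z : X) {a : X} : A a -> (edist_inf A z <= `|z - a|%:E)%E.
Proof. by move=> Aa; rewrite edist_inf_normE; apply: ereal_inf_lbound; exists a. Qed.

Lemma normal_cone_gph_bound {R : realType} {X Y : normedModType R}
    {G : X -> set Y} {x a : X} {y b : Y} {us : dual X} {vs ys : dual Y} :
  normal_cone (gph G) (x, y) (us, vs) -> G a b ->
  ys (y - b) = `|y - b| ->
  `|y - b| <= `|us| * `|x - a| + `|vs + ys| * `|y - b|.
Proof.
move=> /(_ (a, b)) /= N Gab ysE; have {}N := N Gab.
have := ler_dual_norm us (x - a); have := ler_dual_norm (vs + ys) (y - b).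
(* Normality now reads [0 <= us (x - a) + vs (y - b)]; adding [ys (y - b)] makes [vs + ys]
   appear. *)
move: N; rewrite -!dual_normE dualDE -(opprB x a) -(opprB y b) !linearN /= ysE.
move: (vs _) (us _) => v u N; have := ler_norm u; have := ler_norm (v + `|y - b|).
lra.
Qed.

Theorem theorem4p15 (R : realType) (P : Type) (P_neq0 : [set: P] !=set0)
    (X Y : normedModType R) (F : P -> X -> set Y)
    (F_convex : forall p : P,
       @convex_set R (X * Y)%type (gph (F p)))
    (xbar : X) (ybar : Y) (alpha : R) (alpha_gt0 : 0 < alpha)
    (delta mu : \bar R) (delta_gt0 : (0 < delta)%E) (mu_gt0 : (0 < mu)%E)
    (F_subregular : uniformly_subregular F xbar ybar alpha delta mu) :
  forall (p : P) (x : X) (y : Y),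
    eball xbar delta x ->
    ~ sv_inv (F p) ybar x ->
    (F p x `&` eball ybar (alpha%:E * mu)) y ->
    forall ys : dual Y,
      `|ys| = 1 ->
      ys (y - ybar) = `|y - ybar| ->
      (alpha%:E <=
         dist_gamma alpha^-1 (0, - ys)%R (normal_cone (gph (F p)) (x, y)))%E.
Proof.
move=> p x y xdelta xNinv [Fxy]; rewrite /eball/= => ymu ys _ ysE.
apply: le_ereal_inf_tmp => _ [[us vs] N <-].
rewrite lee_fin /norm_gamma/= invrK sub0r normrN -opprD normrN (addrC ys).
have r0 : 0 < `|y - ybar|.
  by rewrite normr_gt0 subr_eq0; apply/eqP => yE; apply: xNinv; rewrite /sv_inv/= -yE.
have dist_le := edist_inf_le_norm ybar Fxy.
have inv_le : (edist_inf (sv_inv (F p) ybar) x <= (`|y - ybar| / alpha)%:E)%E.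
  (* As [y] lies in [F p x], its distance to [ybar] both triggers subregularity at [x] and bounds
     its right-hand side. *)
  rewrite mulrC EFinM lee_pdivlMl// distrC.
  exact: le_trans (F_subregular _ _ xdelta (le_lt_trans dist_le ymu)) dist_le.
have /ler_addgt0Pr main : forall e, 0 < e ->
    `|y - ybar| <= `|us| * (`|y - ybar| / alpha) + `|vs + ys| * `|y - ybar| + e.
  move=> e e0; have u0 : 0 < `|us| + 1 by rewrite ltr_wpDl.
  (* Multiplied by [|us|], the slack stays below [e]; the [+ 1] covers [us = 0]. *)
  have [|a Fa xa] := edist_inf_approx (`|y - ybar| / alpha + e / (`|us| + 1)) inv_le.
    by rewrite ltrDl divr_gt0.
  apply: (le_trans (normal_cone_gph_bound N Fa ysE)).
  rewrite addrAC lerD2r (le_trans (ler_wpM2l _ (ltW xa)))// mulrDr lerD2l.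
  by rewrite mulrA ler_pdivrMr// mulrC ler_pM2l// lerDl.
(* After multiplication by [|y - ybar|], the goal is [main] scaled by [alpha]. *)
rewrite -(ler_pM2r r0).
have := ler_wpM2l (ltW alpha_gt0) main; congr (_ <= _).
by field; rewrite gt_eqF.
Qed.
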